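(* Let $p,q\geq 2$ be coprime integers, $E\in\mathbb{R}$, and let $V:\mathbb{Z}^2\to\mathbb{R}$ be $(p,q)$-periodic. Then the set of all $(\theta,\varphi)\in[0,\tfrac1p)\times[0,\tfrac1q)$ such that $E$ is an eigenvalue of multiplicity $\geq 2$ of $\widehat{H}_{(p,q),(\theta,\varphi)}$ is finite.
   Context: $V:\mathbb{Z}^2\to\mathbb{R}$ is $(p,q)$-periodic if $V(n_1+p,n_2)=V(n_1,n_2)=V(n_1,n_2+q)$ for all $(n_1,n_2)\in\mathbb{Z}^2$. Write $e(x)=\mathrm{e}^{2\pi \mathrm{i}x}$. Let $\mathbb{B}=\{0,\frac1p,\dots,\frac{p-1}{p}\}\times\{0,\frac1q,\dots,\frac{q-1}{q}\}$, regarded as a finite subgroup of $(\mathbb{R}/\mathbb{Z})^2$ (addition modulo 1), and for $k\in\mathbb{B}$ let $\widehat{V}(k)=\frac{1}{pq}\sum_{n_1=0}^{p-1}\sum_{n_2=0}^{q-1}V(n_1,n_2)\,e(-k_1n_1-k_2n_2)$. The Floquet–Bloch operator $\widehat{H}_{(p,q),(\theta,\varphi)}:\ell^2(\mathbb{B})\to\ell^2(\mathbb{B})$ is $$\widehat{H}_{(p,q),(\theta,\varphi)}\psi(\ell)=\big(2\cos(2\pi(\ell_1+\theta))+2\cos(2\pi(\ell_2+\varphi))\big)\psi(\ell)+\sum_{k\in\mathbb{B}}\widehat{V}(k)\,\psi(\ell-k).$$ *)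

(* Defs.v *)
From HB Require Import structures.
From mathcomp Require Import all_boot all_order all_algebra complex.
From mathcomp Require Import classical_sets cardinality reals trigo.

Set Implicit Arguments.
Unset Strict Implicit.
Unset Printing Implicit Defensive.

Import Order.TTheory GRing.Theory Num.Theory.
Local Open Scope ring_scope.
Local Open Scope complex_scope.

Definition periodic2 (R : realType) (p q : nat) (V : int -> int -> R) : Prop :=
  forall n1 n2 : int,
    V (n1 + p%:Z) n2 = V n1 n2 /\ V n1 (n2 + q%:Z) = V n1 n2.

(* e(x) = exp(2 pi i x) *)
Definition e (R : realType) (x : R) : R[i] :=
  cos (2 * pi * x) +i* sin (2 * pi * x).

(* The group {0, 1/p, ..., (p-1)/p} x {0, 1/q, ..., (q-1)/q} (addition mod 1);
   (j1, j2) stands for the point (j1/p, j2/q). This encoding is only meaningful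
   for p, q >= 2, because 'Z_0 and 'Z_1 are both Z/2Z. *)
Notation dualB p q := ('Z_p * 'Z_q)%type.

Definition coord1 (R : realType) (p q : nat) (l : dualB p q) : R :=
  (val l.1)%:R / p%:R.

Definition coord2 (R : realType) (p q : nat) (l : dualB p q) : R :=
  (val l.2)%:R / q%:R.

Arguments coord1 R p q l : clear implicits.
Arguments coord2 R p q l : clear implicits.

Definition Vhat (R : realType) (p q : nat) (V : int -> int -> R)
    (k : dualB p q) : R[i] :=
  (p * q)%N%:R^-1 *
  \sum_(n1 < p) \sum_(n2 < q)
    (V n1%:Z n2%:Z)%:C * e (- (coord1 R p q k * n1%:R) - coord2 R p q k * n2%:R).

(* The regular module R[i]^o makes this a vector space over R[i]. The inner
   product of l^2 plays no role for eigenvalues and their multiplicities. *)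
Notation l2B R p q := {ffun dualB p q -> R[i]^o}.

Arguments Vhat {R} p q V k.

Definition floquet_fun (R : realType) (p q : nat) (V : int -> int -> R)
    (theta phi : R) (psi : l2B R p q) : l2B R p q :=
  [ffun l : dualB p q =>
     (2 * cos (2 * pi * (coord1 R p q l + theta))
      + 2 * cos (2 * pi * (coord2 R p q l + phi)))%:C * psi l
     + \sum_(k : dualB p q) Vhat p q V k * psi (l - k)].

Arguments floquet_fun {R} p q V theta phi psi.

Lemma floquet_fun_linear (R : realType) (p q : nat) (V : int -> int -> R)
    (theta phi : R) : linear (floquet_fun p q V theta phi).
Proof.
move=> a u v; apply/ffunP => l; rewrite !ffunE.
rewrite [a *: (_ + _)]mulrDr mulrDr [a *: u l]/(a * u l) mulrCA -!addrA.
congr (_ + _); rewrite addrCA; congr (_ + _).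
rewrite mulr_sumr -big_split; apply: eq_bigr => k _.
by rewrite !ffunE mulrDr [a *: u _]/(a * u _) mulrCA.
Qed.

HB.instance Definition _ (R : realType) (p q : nat) (V : int -> int -> R)
    (theta phi : R) :=
  GRing.isLinear.Build R[i] (l2B R p q) (l2B R p q) _
    (floquet_fun p q V theta phi) (@floquet_fun_linear R p q V theta phi).

Definition floquet (R : realType) (p q : nat) (V : int -> int -> R)
    (theta phi : R) : 'End(l2B R p q) :=
  linfun (floquet_fun p q V theta phi).

Arguments floquet {R} p q V theta phi.

Lemma floquetE (R : realType) (p q : nat) (V : int -> int -> R)
    (theta phi : R) (psi : l2B R p q) :
  floquet p q V theta phi psi = floquet_fun p q V theta phi psi.
Proof. by rewrite lfunE. Qed.

(* The Floquet operator is self-adjoint, so geometric and algebraic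
   multiplicities coincide. *)
Definition multiplicity (K : fieldType) (U : vectType K) (A : 'End(U)) (a : K)
    : nat := \dim (passmx.leigenspace A a).

(* Main.v *)
(** Put x = e((theta + phi)/2) and y = e((theta - phi)/2). With w = e(1/p) and
    v = e(1/q), the diagonal entry at l of the Floquet operator, times x y, is
    w^l1 (x^2 + a_l) (y^2 + b_l) with a_l = w^-l1 v^-l2 and b_l = w^-l1 v^l2, the
    polynomial form of cos A + cos B = 2 cos((A+B)/2) cos((A-B)/2). So
    f(x, y) = det (x y (H - E)) is a polynomial, and at y = 0 it is a nonzero
    multiple of prod_l (x^2 + a_l), whose degree in x equals that of f. As p and q
    are coprime, the a_l are distinct, so f(x, 0) is separable and the resultant in
    x of f and df/dx is a nonzero polynomial in y. If E has multiplicity at least 2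
    then x is a double root of f(., y), hence y is a root of this resultant and
    takes finitely many values. Exchanging x and y, the same holds for x. *)

Require Import Defs.
From mathcomp Require Import all_boot all_order all_fingroup all_algebra complex.
From mathcomp Require Import separable ring lra.
From mathcomp Require Import classical_sets cardinality reals trigo.

Set Implicit Arguments.
Unset Strict Implicit.
Unset Printing Implicit Defensive.

Import Order.TTheory GRing.Theory Num.Theory.
Local Open Scope ring_scope.
Local Open Scope complex_scope.
Local Open Scope classical_set_scope.

(** * Polynomial matrices, double roots and resultants *)

(* Row operations over F make the last n - r rows of A vanish at x. *)
Lemma dvdp_exp_corank_det (F : fieldType) n (A : 'M[{poly F}]_n) (x : F) :
  ('X - x%:P) ^+ (n - \rank (map_mx (horner_eval x) A)) %| \det A.
Proof.
set Ax := map_mx _ A; set r := \rank Ax.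
(* [G] has constant entries and is invertible, so its determinant is a unit and divisors of
   [\det (G *m A)] divide [\det A]. *)
pose G := map_mx polyC (invmx (col_ebase Ax)).
pose d (i : 'I_n) : {poly F} := if (i < r)%N then 1 else 'X - x%:P.
have GA_dvd i j : d i %| (G *m A) i j.
  rewrite /d; case: ltnP => [_|r_le_i]; first exact: dvd1p.
  rewrite dvdp_XsubCl rootE -/(horner_eval x _).
  have -> : horner_eval x ((G *m A) i j) = map_mx (horner_eval x) (G *m A) i j.
    by rewrite [RHS]mxE.
  rewrite map_mxM -map_mx_comp map_mx_id; last first.
    by move=> a /=; rewrite /horner_eval hornerC.
  rewrite -/Ax -{2}[Ax]mulmx_ebase -mulmxA mulKmx ?col_ebase_unit //.
  rewrite mxE big1 // => k _; rewrite mxE.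
  by rewrite -/r ltnNge r_le_i andbF mul0r.
have GA_fact : G *m A = diag_mx (\row_i d i) *m \matrix_(i, j) ((G *m A) i j %/ d i).
  apply/matrixP => i j; rewrite mul_diag_mx [RHS]mxE [X in X * _]mxE [X in _ * X]mxE.
  by rewrite mulrC divpK.
have detG : \det G \is a GRing.unit.
  by rewrite det_map_mx rmorph_unit // -unitmxE unitmx_inv col_ebase_unit.
have := congr1 (fun M => \det M) GA_fact; rewrite !det_mulmx det_diag => detE.
have -> : ('X - x%:P) ^+ (n - r) = \prod_i (\row_i d i) 0 i.
  rewrite (bigID (fun i : 'I_n => (i < r)%N)) /= big1 ?mul1r; last first.
    by move=> i ir; rewrite mxE /d ir.
  rewrite (eq_bigr (fun=> 'X - x%:P)) => [|i]; last by rewrite mxE /d => /negPf->.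
  rewrite -(big_mkord (fun i => ~~ (i < r)%N) (fun=> 'X - x%:P)).
  rewrite (big_cat_nat (n := r)) //=; last exact: rank_leq_row.
  rewrite big_nat_cond big_pred0 ?mul1r; last by move=> i; rewrite andbN.
  rewrite big_nat_cond (eq_bigl (fun i => (r <= i < n)%N)); last first.
    by move=> i; rewrite -leqNgt andbAC andbb.
  by rewrite -big_nat prodr_const_nat.
rewrite -(mulKr detG (\det A)) detE mulrC -mulrA.
exact: dvdp_mulr.
Qed.

Lemma root_deriv_sqr_dvdp (F : fieldType) (p : {poly F}) (x : F) :
  ('X - x%:P) ^+ 2 %| p -> root p x /\ root p^`() x.
Proof.
move=> /dvdpP[q ->]; rewrite !rootE expr2 !derivM derivXsubC.
by rewrite !(hornerXsubC, hornerM, hornerD) subrr !(mulr0, mul0r, addr0).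
Qed.

(** Each factor is separable because [a i] is nonzero, and two factors are coprime because they
    differ by the nonzero constant [a i - a j]. *)
Lemma separable_prod_sqr (F : numFieldType) (I : eqType) (s : seq I) (a : I -> F) :
  injective a -> (forall i, a i != 0) -> uniq s ->
  separable_poly (\prod_(i <- s) ('X^2 + (a i)%:P)).
Proof.
move=> a_inj a_neq0; elim: s => [|i s IHs] /=.
  by rewrite big_nil unlock /separable_poly coprime1p.
case/andP=> i_s s_uniq; rewrite big_cons separable_mul.
apply/and3P; split; [|exact: IHs|].
  rewrite unlock; apply/Bezout_eq1_coprimepP.
  (* The derivative is [2 * 'X]; multiplied by [(2 * a i)^-1 * 'X] it cancels the square term of the
     first product and leaves 1. *)
  exists ((a i)^-1%:P, - (2 * a i)^-1%:P * 'X) => /=.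
  transitivity (((a i)^-1 - (2 * a i)^-1 * 2)%:P * 'X^2 + ((a i)^-1 * a i)%:P).
    by rewrite derivD derivXn derivC; ring.
  by rewrite mulVf // invfM mulrAC mulVf ?pnatr_eq0 // mul1r subrr mul0r add0r.
elim: s i_s {s_uniq IHs} => [|j s IHs]; first by rewrite big_nil coprimep1.
rewrite inE negb_or => /andP[ij i_s]; rewrite big_cons coprimepMr.
apply/andP; split; last exact: IHs.
apply/Bezout_eq1_coprimepP.
exists ((a i - a j)^-1%:P, - (a i - a j)^-1%:P) => /=.
transitivity (((a i - a j)^-1 * (a i - a j))%:P); first by ring.
by rewrite mulVf // subr_eq0 (inj_eq a_inj).
Qed.

(** The outer variable is x, the inner one y. Since the degree in x does not drop at y = 0, the
    resultant of [f] and its x-derivative specialises there to that of [f0], which is nonzero by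
    separability. *)
Lemma double_root_locus (F : numFieldType) (f : {poly {poly F}}) :
  let f0 := map_poly (horner_eval 0) f in
  (2 < size f)%N -> (size f <= size f0)%N -> separable_poly f0 ->
  exists2 g : {poly F}, g != 0 & forall x y,
    ('X - x%:P) ^+ 2 %| map_poly (horner_eval y) f -> root g y.
Proof.
move=> f0 f_gt2 sz_f sep_f0.
have sz : size f = size f0 by apply/eqP; rewrite eqn_leq sz_f size_poly.
have f0_neq0 : f0 != 0 by apply: separable_poly_neq0.
have lc : horner_eval 0 (lead_coef f) != 0.
  by rewrite lead_coefE sz -coef_map -/f0 -lead_coefE lead_coef_eq0.
have f_gt1 : (1 < size f)%N by apply: ltnW.
(* This coefficient is the leading coefficient of [f] times the degree of [f], a nonzero integer in
   characteristic 0. *)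
have lc' : horner_eval 0 (f^`()`_(size f).-2) != 0.
  rewrite coef_deriv rmorphMn mulrn_eq0 /=.
  by move: lc; rewrite lead_coefE; case: (size f) f_gt1 => [|[|m]].
have sz' : size f^`() = (size f).-1.
  rewrite size_poly_eq // -coef_deriv.
  by apply: contraNneq lc' => ->; rewrite rmorph0.
have f'_gt1 : (1 < size f^`())%N by rewrite sz' -subn1 ltn_subRL.
have res0 : horner_eval 0 (resultant f f^`()) = resultant f0 f0^`().
  by rewrite map_resultant ?deriv_map // lead_coefE sz'.
exists (resultant f f^`()) => [|x y sqr_dvd].
  apply: contraTneq sep_f0 => res_eq0.
  have := resultant_eq0 f0 f0^`(); rewrite -res0 res_eq0 rmorph0 eqxx.
  by rewrite unlock /coprimep => /esym /gtn_eqF ->.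
have [fx0 f'x0] := root_deriv_sqr_dvdp sqr_dvd.
(* The resultant lies in the ideal of [f] and its derivative; both vanish at (x, y), so it vanishes
   at y. *)
have [[u v] /= [_ _ resE]] := resultant_in_ideal f_gt1 f'_gt1.
have := congr1 (fun g => (map_poly (horner_eval y) g).[x]) resE.
rewrite map_polyC hornerC rmorphD !rmorphM hornerD !hornerM /=.
rewrite deriv_map in f'x0.
by rewrite (rootP fx0) (rootP f'x0) !mulr0 addr0 => /rootP.
Qed.

Lemma size_det_leq (F : comNzRingType) n (A : 'M[{poly F}]_n) m :
  (forall i j, (size (A i j) <= m.+1)%N) -> (size (\det A) <= (n * m).+1)%N.
Proof.
move=> szA; apply: (leq_trans (size_sum _ _ _)); apply/bigmax_leqP => s _.
have -> : size ((-1) ^+ odd_perm s * \prod_i A i (s i)) = size (\prod_i A i (s i)).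
  by case: (odd_perm s); rewrite ?mulN1r ?mul1r ?size_polyN.
apply: (leq_trans (size_poly_prod_leq _ _)).
rewrite leq_subLR card_ord addnS ltnS -mulnS.
apply: (@leq_trans (\sum_(i < n) m.+1)); first by apply: leq_sum => i _.
by rewrite sum_nat_const card_ord.
Qed.

(** Corank 2 makes x a double root of the determinant. At y = 0 the coupling by [K] disappears,
    leaving a constant times the product of the ['X^2 + a i], separable and already of full degree
    2n in x. *)
Lemma corank2_locus (F : numFieldType) n (a b c : 'I_n -> F) (K : 'M[F]_n) :
  injective a -> (forall i, a i != 0) -> (forall i, b i != 0) ->
  (forall i, c i != 0) ->
  exists2 g : {poly F}, g != 0 & forall x y,
    ((\rank (\matrix_(i, j) (c i * (x ^+ 2 + a i) * (y ^+ 2 + b i) *+ (i == j)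
       + x * y * K i j)%R)).+2 <= n)%N -> root g y.
Proof.
move=> a_inj a_neq0 b_neq0 c_neq0.
(* For n = 0 the determinant is 1, too small for [double_root_locus], but the rank condition cannot
   hold. *)
case: (posnP n) => [n0 | n_gt0].
  by exists 1; rewrite ?oner_neq0 // => x y /leq_trans/(_ (eq_leq n0)).
(* Inside the outermost [%:P] the variable ['X] is y; outside it is x. *)
pose M : 'M[{poly {poly F}}]_n := \matrix_(i, j)
  (((c i)%:P * ('X^2 + (b i)%:P))%:P * ('X^2 + (a i)%:P%:P) *+ (i == j)
     + ('X * (K i j)%:P)%:P * 'X).
have evalM y : map_mx (map_poly (horner_eval y)) M = \matrix_(i, j)
    ((c i * (y ^+ 2 + b i))%:P * ('X^2 + (a i)%:P) *+ (i == j)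
     + (y * K i j)%:P * 'X).
  apply/matrixP => i j; rewrite !mxE !(rmorphD, rmorphMn, rmorphM, rmorphXn) /= !(map_polyC, map_polyX).
  by rewrite /= /horner_eval !hornerE.
pose f := \det M.
have evalf y : map_poly (horner_eval y) f = \det (map_mx (map_poly (horner_eval y)) M).
  by rewrite det_map_mx.
have f0E : map_poly (horner_eval 0) f =
    (\prod_i (c i * b i)) *: \prod_i ('X^2 + (a i)%:P).
  rewrite evalf evalM -mul_polyC rmorph_prod -big_split /=.
  have -> : (\matrix_(i, j) ((c i * (0 ^+ 2 + b i))%:P * ('X^2 + (a i)%:P) *+ (i == j)
     + (0 * K i j)%:P * 'X)) = diag_mx (\row_i ((c i * b i)%:P * ('X^2 + (a i)%:P))).
    by apply/matrixP => i j; rewrite !mxE expr0n /= mul0r mul0r !add0r addr0.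
  by rewrite det_diag; apply: eq_bigr => i _; rewrite mxE.
have cb_neq0 : \prod_i (c i * b i) != 0.
  by apply/prodf_neq0 => i _; rewrite mulf_neq0.
have szf0 : size (map_poly (horner_eval 0) f) = (n * 2).+1.
  rewrite f0E size_scale // size_prod => [|i _]; last by rewrite -size_poly_eq0 size_XnaddC.
  rewrite (eq_bigr (fun=> 3)) => [|i _]; last by rewrite size_XnaddC.
  by rewrite sum_nat_const card_ord (mulnS n 2) -addnS addKn.
have szf : (size f <= (n * 2).+1)%N.
  apply: size_det_leq => i j; rewrite mxE.
  apply: leq_trans (size_polyD _ _) _; rewrite geq_max; apply/andP; split.
    case: (i == j); rewrite ?mulr0n ?mulr1n ?size_poly0 // mul_polyC.
    by apply: leq_trans (size_scale_leq _ _) _; rewrite size_XnaddC.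
  by rewrite mul_polyC (leq_trans (size_scale_leq _ _)) // size_polyX.
have [|||g g_neq0 gP] := @double_root_locus F f.
- by apply: (@leq_trans (n * 2).+1); rewrite -?szf0 ?size_poly // szf0 ltnS (leq_mul2r 2 1 n).
- by rewrite szf0.
- rewrite f0E (eqp_separable (eqp_scale _ cb_neq0)) //.
  by apply: separable_prod_sqr => //; apply: index_enum_uniq.
exists g => // x y rkM; apply: (gP x).
rewrite evalf; apply: dvdp_trans (dvdp_exp_corank_det _ x); apply: dvdp_exp2l.
rewrite leq_subRL ?rank_leq_row // addn2.
apply: leq_trans rkM; rewrite !ltnS; apply: eq_leq; congr (\rank _).
apply/matrixP => i j; rewrite evalM !mxE.
by rewrite /horner_eval; case: (i == j); rewrite /= !hornerE; ring.
Qed.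

(** * The character [e] and roots of unity *)

Lemma eD (R : realType) (s t : R) : e (s + t) = e s * e t.
Proof. by rewrite /e mulrDr cosD sinD; simpc; congr (_ +i* _); rewrite addrC. Qed.

Lemma e0 (R : realType) : e (0 : R) = 1.
Proof. by rewrite /e mulr0 cos0 sin0. Qed.

Lemma e_neq0 (R : realType) (t : R) : e t != 0.
Proof.
apply/eqP => et0; have := e0 R.
by rewrite -(subrr t) eD et0 mul0r => /eqP; rewrite eq_sym oner_eq0.
Qed.

Lemma eN (R : realType) (t : R) : e (- t) = (e t)^-1.
Proof. by apply: (mulfI (e_neq0 t)); rewrite -eD subrr e0 divff // e_neq0. Qed.

Lemma e1 (R : realType) : e (1 : R) = 1.
Proof. by rewrite /e mulr1 mulr_natl cos2pi sin2pi. Qed.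

Lemma eMn (R : realType) (t : R) n : e (t *+ n) = e t ^+ n.
Proof. by elim: n => [|n IHn]; rewrite ?e0 // mulrS eD IHn exprS. Qed.

Lemma cos_e (R : realType) (t : R) : (2 * cos (2 * pi * t))%:C = e t + e (- t).
Proof.
rewrite /e mulrN cosN sinN; apply/eqP; rewrite eq_complex /= subrr eqxx andbT.
by apply/eqP; ring.
Qed.

(** By the double angle formula cos(2 pi t) = 1 forces sin(pi t) = 0, which is excluded for 0 < t <
    1. *)
Lemma e_eq1 (R : realType) (t : R) : `|t| < 1 -> e t = 1 -> t = 0.
Proof.
wlog t_ge0 : t / 0 <= t => [wt|].
  case: (leP 0 t) => [|/ltW t_le0 t_lt1 et]; first exact: wt.
  by apply/eqP; rewrite -oppr_eq0; apply/eqP/wt; rewrite ?normrN ?oppr_ge0 // eN et invr1.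
rewrite ger0_norm // => t_lt1 [+ _].
move: t_ge0; rewrite le_eqVlt => /orP[/eqP <- //|t_gt0].
have : 0 < sin (pi * t).
  by rewrite sin_gt0_pi // mulr_gt0 ?pi_gt0 //= gtr_pMr // pi_gt0.
rewrite -mulrA mulr_natl cos_mulr2n => s_gt0 cos_eq.
have := cos2Dsin2 (pi * t); have := exprn_gt0 2 s_gt0; lra.
Qed.

Lemma e_inj (R : realType) (s t : R) : `|s - t| < 1 -> e s = e t -> s = t.
Proof.
move=> st_lt1 est; apply/eqP; rewrite -subr_eq0; apply/eqP/e_eq1 => //.
by rewrite eD eN est; apply/divff/e_neq0.
Qed.

Lemma e_prim_root (R : realType) n : (0 < n)%N -> n.-primitive_root (e (n%:R^-1 : R)).
Proof.
move=> n_gt0; apply/andP; split=> //; apply/forallP => i; apply/eqP.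
rewrite unity_rootE -eMn -[_^-1 *+ _]mulr_natl.
apply/eqP/eqP => [/e_eq1|->]; last by rewrite divff ?e1 // pnatr_eq0 -lt0n.
have [i_lt|] := ltnP i.+1 n; last by rewrite leq_eqVlt ltnNge ltn_ord orbF => /eqP.
rewrite ger0_norm ?divr_ge0 // ltr_pdivrMr ?ltr0n // mul1r ltr_nat => /(_ i_lt) /eqP.
by rewrite mulf_eq0 invr_eq0 !pnatr_eq0 /= gtn_eqF.
Qed.

Lemma prim_rootV (F : fieldType) n (z : F) :
  n.-primitive_root z -> n.-primitive_root z^-1.
Proof.
case/andP=> n_gt0 /forallP zP; apply/andP; split=> //; apply/forallP => i.
by rewrite -(eqP (zP i)) !unity_rootE exprVn invr_eq1.
Qed.

(** Raising to the power p removes the factor in [w], while [v ^+ p] stays a primitive q-th root by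
    coprimality; this determines the second exponent, and symmetrically the first. *)
Lemma prim_root_prod_inj (F : fieldType) p q (w v : F) :
  (1 < p)%N -> (1 < q)%N -> coprime p q ->
  p.-primitive_root w -> q.-primitive_root v ->
  injective (fun l : dualB p q => w ^+ l.1 * v ^+ l.2).
Proof.
move=> p_gt1 q_gt1 pq w_prim v_prim.
have key r s (x y : F) (i i' j j' : nat) : coprime r s -> r.-primitive_root x ->
    s.-primitive_root y -> (j < s)%N -> (j' < s)%N ->
    x ^+ i * y ^+ j = x ^+ i' * y ^+ j' -> j = j'.
  move=> rs x_prim y_prim js j's /(congr1 (fun z => z ^+ r)).
  rewrite !exprMn -!exprM ![(_ * r)%N]mulnC !exprM (prim_expr_order x_prim).
  rewrite !expr1n !mul1r => /eqP; rewrite (@eq_prim_root_expr _ s).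
    by rewrite !modn_small // => /eqP.
  by rewrite prim_root_exp_coprime.
have lt_Zp m (k : 'Z_m) : (1 < m)%N -> (k < m)%N.
  by move=> m_gt1; rewrite -[X in (_ < X)%N](Zp_cast m_gt1) ltn_ord.
move=> [i j] [i' j'] /= eq_l; congr pair; apply: val_inj => /=.
  move: eq_l; rewrite mulrC [RHS]mulrC => eq_l.
  by apply: (key q p v w _ _ _ _ _ _ _ _ _ eq_l); rewrite 1?coprime_sym ?lt_Zp.
by apply: (key p q w v _ _ _ _ _ _ _ _ _ eq_l); rewrite ?lt_Zp.
Qed.

(** * Eigenspaces, root sets and the Floquet matrix *)

(** A basis of [U], written in coordinates, gives a matrix with [\dim U] independent rows whose
    product with [M^T] is zero. *)
Lemma dim_ffun_corank (K : fieldType) (T : finType) (U : {vspace {ffun T -> K^o}})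
    m (M : 'M[K]_(m, #|T|)) :
  (forall psi, psi \in U -> forall i, \sum_j M i j * psi (enum_val j) = 0) ->
  (\dim U + \rank M <= #|T|)%N.
Proof.
move=> MU.
pose W : 'M[K]_(\dim U, #|T|) := \matrix_(i, j) (vbasis U)`_i (enum_val j).
have W_free : row_free W.
  apply: inj_row_free => v vW0; apply/rowP => i; rewrite mxE.
  move/freeP: (basis_free (vbasisP U)) => /(_ (v 0)); apply.
  apply/ffunP => t; rewrite sum_ffunE ffunE.
  have /rowP/(_ (enum_rank t)) := vW0; rewrite !mxE => vWt.
  rewrite -[RHS]vWt.
  by apply: eq_bigr => k _; rewrite ffunE mxE enum_rankK.
have WM0 : W *m M^T = 0.
  apply/matrixP => i j; rewrite !mxE.
  have Ui : (vbasis U)`_i \in U by apply/vbasis_mem/mem_nth; rewrite size_tuple.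
  by rewrite -[RHS](MU _ Ui j); apply: eq_bigr => k _; rewrite !mxE mulrC.
have := mulmx0_rank_max WM0.
by rewrite mxrank_tr; move: W_free; rewrite /row_free => /eqP ->.
Qed.

Lemma finite_rootset (F : closedFieldType) (g : {poly F}) :
  g != 0 -> finite_set [set x | root g x]%classic.
Proof.
move=> g_neq0; have [s gE] := closed_field_poly_normal g.
apply: (@sub_finite_set _ _ [set` s]%classic) => // x /=.
by rewrite gE rootZ ?lead_coef_eq0 // root_prod_XsubC.
Qed.

(** The substitution k = l - l' turns the convolution into a matrix product. *)
Lemma floquet_eigenspace_sum (R : realType) (p q : nat) (V : int -> int -> R)
    (theta phi E : R) (psi : l2B R p q) (l : dualB p q) :
  psi \in passmx.leigenspace (floquet p q V theta phi) E%:C ->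
  \sum_l' ((2 * cos (2 * pi * (coord1 R p q l + theta))
      + 2 * cos (2 * pi * (coord2 R p q l + phi)))%:C *+ (l == l')
     + (Vhat p q V (l - l') - E%:C *+ (l == l'))) * psi l' = 0.
Proof.
rewrite memv_ker => /eqP; rewrite !lfun_simp => /ffunP/(_ l).
rewrite !ffunE (reindex_inj (can_inj (subKr l))) /=.
under eq_bigr do rewrite subKr.
move=> psi_l.
rewrite -[RHS]psi_l.
set d := (_ + _)%:C.
transitivity (\sum_l' ((d - E%:C) * psi l' *+ (l == l') + Vhat p q V (l - l') * psi l')).
  by apply: eq_bigr => l' _; case: eqVneq => _; rewrite ?mulr0n ?mulr1n; ring.
rewrite big_split /= (bigD1 l) //= eqxx big1 ?addr0 => [|l' /negPf ll'].
  by rewrite mulrBl addrAC.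
by rewrite eq_sym ll'.
Qed.

(** Here e(theta) = x y and e(phi) = x / y, so the cosines become Laurent monomials in x and y whose
    sum factors. *)
Lemma floquet_symbol (R : realType) (p q : nat) (theta phi : R) (l : dualB p q) :
  let w : R[i] := e p%:R^-1 in let v : R[i] := e q%:R^-1 in
  let x := e ((theta + phi) / 2) in let y := e ((theta - phi) / 2) in
  x * y * (2 * cos (2 * pi * (coord1 R p q l + theta))
      + 2 * cos (2 * pi * (coord2 R p q l + phi)))%:C =
  w ^+ l.1 * (x ^+ 2 + (w ^+ l.1 * v ^+ l.2)^-1) * (y ^+ 2 + w^-1 ^+ l.1 * v ^+ l.2).
Proof.
move=> w v x y; rewrite rmorphD /= !cos_e !eN !eD.
have -> : e (coord1 R p q l) = w ^+ l.1 by rewrite -eMn -[_^-1 *+ _]mulr_natl.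
have -> : e (coord2 R p q l) = v ^+ l.2 by rewrite -eMn -[_^-1 *+ _]mulr_natl.
have -> : e theta = x * y by rewrite -eD; congr e; field.
have -> : e phi = x / y by rewrite -eN -eD; congr e; field.
have x0 : x != 0 := e_neq0 _. have y0 : y != 0 := e_neq0 _.
rewrite exprVn.
have : w ^+ l.1 != 0 by rewrite expf_neq0 // e_neq0.
have : v ^+ l.2 != 0 by rewrite expf_neq0 // e_neq0.
move: (w ^+ _) (v ^+ _) => W U U0 W0.
by field; rewrite x0 y0 U0 W0.
Qed.

Theorem theorem5p1 (R : realType) (p q : nat) (hp : (2 <= p)%N)
    (hq : (2 <= q)%N) (hpq : coprime p q) (E : R) (V : int -> int -> R)
    (hV : periodic2 p q V) :
  finite_set [set x : R * R |
    [/\ 0 <= x.1 < p%:R^-1, 0 <= x.2 < q%:R^-1 &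
        (2 <= multiplicity (floquet p q V x.1 x.2) E%:C)%N]].
Proof.
set A := [set x : R * R | _].
pose n := #|{: dualB p q}|.
pose l (i : 'I_n) : dualB p q := enum_val i.
pose w : R[i] := e p%:R^-1.
pose v : R[i] := e q%:R^-1.
pose a i := (w ^+ (l i).1 * v ^+ (l i).2)^-1.
pose b i := w^-1 ^+ (l i).1 * v ^+ (l i).2.
pose c i := w ^+ (l i).1.
pose K := \matrix_(i < n, j < n) (Vhat p q V (l i - l j) - E%:C *+ (l i == l j)).
have w_prim : p.-primitive_root w by apply/e_prim_root/ltnW.
have v_prim : q.-primitive_root v by apply/e_prim_root/ltnW.
have w_neq0 : w != 0 by apply: e_neq0.
have v_neq0 : v != 0 by apply: e_neq0.
have a_inj : injective a.
  by move=> i j /invr_inj /(prim_root_prod_inj hp hq hpq w_prim v_prim) /enum_val_inj.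
have b_inj : injective b.
  by move=> i j /(prim_root_prod_inj hp hq hpq (prim_rootV w_prim) v_prim) /enum_val_inj.
have c_neq0 i : c i != 0 by rewrite expf_neq0.
have a_neq0 i : a i != 0 by rewrite invr_eq0 mulf_neq0 ?expf_neq0.
have b_neq0 i : b i != 0 by rewrite mulf_neq0 ?expf_neq0 ?invr_eq0.
pose X (t : R * R) := e ((t.1 + t.2) / 2).
pose Y (t : R * R) := e ((t.1 - t.2) / 2).
have rkM t : A t -> ((\rank (\matrix_(i, j) (c i * (X t ^+ 2 + a i) * (Y t ^+ 2 + b i)
    *+ (i == j) + X t * Y t * K i j)%R)).+2 <= n)%N.
  (* The eigenspace is annihilated by [M], which is x y (H - E), so the corank of [M] is at least
     the multiplicity. *)
  case=> _ _ mult; set M := (\matrix_(i, j) _)%R.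
  apply: (@leq_trans (multiplicity (floquet p q V t.1 t.2) E%:C + \rank M)).
    by rewrite -add2n leq_add2r.
  apply: dim_ffun_corank.
  move=> psi /floquet_eigenspace_sum psiE i.
  have := congr1 ( *%R (X t * Y t)) (psiE (l i)).
  rewrite mulr0 (big_enum_val (A := predT)) mulr_sumr; apply: etrans.
  apply: eq_bigr => j _; rewrite !mxE mulrA; congr (_ * _).
  rewrite [RHS]mulrDr; congr (_ + _).
  by rewrite -[_ *+ (l i == _)]mulr_natr mulrA floquet_symbol mulr_natr (inj_eq enum_val_inj).
have [g g_neq0 gP] := corank2_locus K a_inj a_neq0 b_neq0 c_neq0.
(* Swapping [a] and [b] exchanges x and y: [h] constrains [X t] as [g] constrains [Y t]. *)
have [h h_neq0 hP] := corank2_locus K b_inj b_neq0 a_neq0 c_neq0.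
(* As p and q are at least 2, the half sum lies in [0, 1/2) and the half difference in (-1/4, 1/4),
   so [e] is injective on each range. *)
have XY_inj : {in A &, injective (fun t => (X t, Y t))}.
  move=> s t /set_mem[s1 s2 _] /set_mem[t1 t2 _] XY_eq.
  have X_eq : X s = X t := congr1 fst XY_eq.
  have Y_eq : Y s = Y t := congr1 snd XY_eq.
  have p2 : p%:R^-1 <= 2^-1 :> R by rewrite lef_pV2 ?posrE ?ltr0n ?ler_nat // ltnW.
  have q2 : q%:R^-1 <= 2^-1 :> R by rewrite lef_pV2 ?posrE ?ltr0n ?ler_nat // ltnW.
  have {}X_eq : (s.1 + s.2) / 2 = (t.1 + t.2) / 2 by apply: e_inj X_eq; rewrite ltr_norml; lra.
  have {}Y_eq : (s.1 - s.2) / 2 = (t.1 - t.2) / 2 by apply: e_inj Y_eq; rewrite ltr_norml; lra.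
  by rewrite (surjective_pairing s) (surjective_pairing t); congr pair; lra.
rewrite -(eq_finite_set (inj_card_eq XY_inj)).
apply: sub_finite_set (finite_setX (finite_rootset h_neq0) (finite_rootset g_neq0)).
move=> _ [t At <-]; split=> /=; last exact: gP (rkM t At).
apply: (hP (Y t)); apply: leq_trans (rkM t At); rewrite !ltnS; apply: eq_leq.
congr (\rank _); apply/matrixP => i j; rewrite !mxE; congr (_ *+ _ + _ * _); ring.
Qed.
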